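(* Let $A$ and $B$ be skew shapes. If $s_A - s_B$ is $F$-positive, then the following three equivalent conditions are true: (1) $\mathrm{rows}_k(A) \preceq \mathrm{rows}_k(B)$ for all $k\ge 1$; (2) $\mathrm{cols}_\ell(A) \preceq \mathrm{cols}_\ell(B)$ for all $\ell\ge 1$; (3) $\mathrm{rects}_{k,\ell}(A) \le \mathrm{rects}_{k,\ell}(B)$ for all $k,\ell\ge 1$.
   Context: A composition of $n$ is a sequence of positive integers with sum $n$; a partition is a weakly decreasing composition. Compositions $\alpha=(\alpha_1,\dots,\alpha_k)$ of $n$ correspond bijectively to subsets of $[n-1]=\{1,\dots,n-1\}$ via $S(\alpha)=\{\alpha_1,\alpha_1+\alpha_2,\dots,\alpha_1+\cdots+\alpha_{k-1}\}$. Young diagrams are left-justified with row $1$ at the top; a skew shape $\lambda/\mu$ is the Young diagram of $\lambda$ with the boxes of $\mu\subseteq\lambda$ removed from its top-left. A standard Young tableau (SYT) of a skew shape $A$ with $n$ boxes is a filling of the boxes by $1,\dots,n$, each used once, increasing left to right along rows and down columns. Its descent set is the set of $i$ such that $i+1$ appears in a strictly lower row than $i$, and its descent composition is the composition of $n$ corresponding to its descent set. The monomial quasisymmetric functions are $M_\alpha=\sum_{i_1<\cdots<i_k}x_{i_1}^{\alpha_1}\cdots x_{i_k}^{\alpha_k}$, and the fundamental quasisymmetric functions are $F_\alpha=\sum_{S(\alpha)\subseteq S(\beta)\subseteq[n-1]}M_\beta$ for $\alpha$ of size $n$; they form a basis of the quasisymmetric functions. The skew Schur function is $s_A=\sum_T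 F_{\mathrm{comp}(T)}$, the sum being over all SYT $T$ of shape $A$, where $\mathrm{comp}(T)$ is the descent composition of $T$. A quasisymmetric function is $F$-positive if all its coefficients in the $F$-basis are nonnegative. For a skew shape $A$ with $r$ rows and $1\le i\le r-k+1$, let $\mathrm{overlap}_k(i)$ be the number of columns occupied in common by rows $i,i+1,\dots,i+k-1$; $\mathrm{rows}_k(A)$ is the partition obtained by sorting $(\mathrm{overlap}_k(1),\dots,\mathrm{overlap}_k(r-k+1))$ into weakly decreasing order and omitting zeros (so it is the empty partition if there are no nonzero overlaps). $\mathrm{cols}_\ell(A)$ is defined in the same way with the roles of rows and columns exchanged. $\mathrm{rects}_{k,\ell}(A)$ is the number of $k\times\ell$ rectangular subdiagrams ($k$ rows, $\ell$ columns, consecutive) contained in $A$. Dominance order, for partitions possibly of different sizes: $\lambda=(\lambda_1,\dots,\lambda_r)\preceq\mu=(\mu_1,\dots,\mu_s)$ if $\lambda_1+\cdots+\lambda_k\le\mu_1+\cdots+\mu_k$ for all $k=1,\dots,r$, where $\mu_i=0$ for $i>s$. *)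

(* Defs.v *)
From mathcomp Require Import all_boot all_order all_algebra.
From mathcomp Require Import finmap monalg.
Set Implicit Arguments.
Unset Strict Implicit.
Unset Printing Implicit Defensive.
Import Order.TTheory GRing.Theory Num.Theory.
Local Open Scope ring_scope.

Definition is_comp (a : seq nat) : bool := all (leq 1) a.

Definition is_comp_of (n : nat) (a : seq nat) : bool :=
  is_comp a && (sumn a == n).

Definition is_part (p : seq nat) : bool := is_comp p && sorted geq p.

(* S(a) = {a_1, a_1 + a_2, ..., a_1 + ... + a_(k-1)}, listed increasingly. *)
Definition comp_set (a : seq nat) : seq nat :=
  [seq sumn (take i a) | i <- iota 1 (size a).-1].

(* Inverse of comp_set on compositions of n: for d_1 < ... < d_(k-1) in
   {1, ..., n-1}, the composition (d_1, d_2 - d_1, ..., n - d_(k-1)). The case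
   n = 0 is separate because the only composition of 0 is the empty one. *)
Definition comp_of_set (n : nat) (ds : seq nat) : seq nat :=
  if n == 0%N then [::]
  else pairmap (fun x y => y - x)%N 0%N (rcons ds n).

(* Weak dominance; the sizes of p and q may differ, and [take] past the end of
   q amounts to padding q with zeros. *)
Definition dominated (p q : seq nat) : Prop :=
  forall k : nat, (1 <= k <= size p)%N ->
    (sumn (take k p) <= sumn (take k q))%N.

(* Formal power series in x_0, x_1, x_2, ...; f m is the coefficient of the
   monomial m. *)
Definition pseries : Type := {cmonom nat} -> rat.

(* The nonzero exponents of m, by increasing index of the variable. *)
Definition exponents (m : {cmonom nat}) : seq nat :=
  [seq m i | i <- sort leq (finsupp m)].

(* A monomial is x_(i_1)^(a_1) ... x_(i_k)^(a_k) for some i_1 < ... < i_k, which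
   are then unique, exactly when its sequence of nonzero exponents is a. *)
Definition monomial_qsym (a : seq nat) : pseries :=
  fun m => (exponents m == a)%:R.

(* Every composition b of n has at most n parts, all of them at most n, so b
   ranges over n.-bseq 'I_n.+1. *)
Definition fundamental_qsym (a : seq nat) : pseries := fun m =>
  let n := sumn a in
  \sum_(b : n.-bseq 'I_n.+1 |
         is_comp_of n (map val b)
         && all [in comp_set (map val b)] (comp_set a))
    monomial_qsym (map val b) m.

Definition F_expansion (f : pseries) (c : {fsfun seq nat -> rat with 0}) : Prop :=
  {in finsupp c, forall a, is_comp a} /\
  forall m, f m = \sum_(a <- finsupp c) c a * fundamental_qsym a m.

Definition F_positive (f : pseries) : Prop :=
  exists2 c : {fsfun seq nat -> rat with 0},
    F_expansion f c & forall a, 0 <= c a.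

Record skew_shape := SkewShape {
  outer : seq nat;
  inner : seq nat;
  outer_part : is_part outer;
  inner_part : is_part inner;
  inner_sub_outer : forall i, (nth 0%N inner i <= nth 0%N outer i)%N
}.

(* Rows and columns are numbered from 0, row 0 being at the top. *)
Definition in_skew (A : skew_shape) (i j : nat) : bool :=
  (nth 0 (inner A) i <= j < nth 0 (outer A) i)%N.

Definition nrows (A : skew_shape) : nat := size (outer A).
Definition ncols (A : skew_shape) : nat := head 0%N (outer A).

Definition box (A : skew_shape) : finType :=
  {p : 'I_(nrows A) * 'I_(ncols A) | in_skew A p.1 p.2}.

Definition brow (A : skew_shape) (b : box A) : nat := (sval b).1.
Definition bcol (A : skew_shape) (b : box A) : nat := (sval b).2.

Definition nboxes (A : skew_shape) : nat := #|box A|.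

(* A filling stores the entry v as the ordinal v - 1. *)
Definition filling (A : skew_shape) : finType :=
  {ffun box A -> 'I_(nboxes A)}.

Definition entry (A : skew_shape) (T : filling A) (b : box A) : nat :=
  (T b : nat).+1.

(* There are as many boxes as available entries, so injectivity says that each
   entry is used exactly once. *)
Definition is_syt (A : skew_shape) (T : filling A) : bool :=
  [&& injectiveb T,
      [forall b, forall b', (brow b == brow b') && (bcol b < bcol b')%N
                              ==> (entry T b < entry T b')%N]
    & [forall b, forall b', (bcol b == bcol b') && (brow b < brow b')%N
                              ==> (entry T b < entry T b')%N]].

Definition descents (A : skew_shape) (T : filling A) : seq nat :=
  [seq i <- iota 1 (nboxes A).-1 |
    [exists b, exists b',
      [&& entry T b == i, entry T b' == i.+1 & (brow b < brow b')%N]]].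

Definition descent_comp (A : skew_shape) (T : filling A) : seq nat :=
  comp_of_set (nboxes A) (descents T).

Definition skew_schur (A : skew_shape) : pseries := fun m =>
  \sum_(T : filling A | is_syt T) fundamental_qsym (descent_comp T) m.

Definition row_overlap (A : skew_shape) (k i : nat) : nat :=
  count (fun j => all (fun i' => in_skew A i' j) (iota i k)) (iota 0 (ncols A)).

Definition col_overlap (A : skew_shape) (l j : nat) : nat :=
  count (fun i => all (fun j' => in_skew A i j') (iota j l)) (iota 0 (nrows A)).

Definition part_of_seq (s : seq nat) : seq nat :=
  sort geq [seq x <- s | x != 0%N].

Definition rows_ (A : skew_shape) (k : nat) : seq nat :=
  part_of_seq [seq row_overlap A k i | i <- iota 0 ((nrows A).+1 - k)].

Definition cols_ (A : skew_shape) (l : nat) : seq nat :=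
  part_of_seq [seq col_overlap A l j | j <- iota 0 ((ncols A).+1 - l)].

(* A rectangle is counted by its top-left box. *)
Definition rects (A : skew_shape) (k l : nat) : nat :=
  #|[set p : 'I_(nrows A) * 'I_(ncols A) |
      all (fun i => all (fun j => in_skew A i j) (iota p.2 l)) (iota p.1 k)]|.

Definition rows_cond (A B : skew_shape) : Prop :=
  forall k : nat, (1 <= k)%N -> dominated (rows_ A k) (rows_ B k).

Definition cols_cond (A B : skew_shape) : Prop :=
  forall l : nat, (1 <= l)%N -> dominated (cols_ A l) (cols_ B l).

Definition rects_cond (A B : skew_shape) : Prop :=
  forall k l : nat, (1 <= k)%N -> (1 <= l)%N ->
    (rects A k l <= rects B k l)%N.

(* Main.v *)
Require Import Defs.
From mathcomp Require Import all_boot all_order all_algebra.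
From mathcomp Require Import finmap monalg.
From mathcomp Require Import zify lra.
Set Implicit Arguments.
Unset Strict Implicit.
Unset Printing Implicit Defensive.
Import Order.TTheory GRing.Theory Num.Theory.
Local Open Scope ring_scope.

(** The number of k x l rectangles of A is the sum over the parts x of rows_k(A)
    of (x - (l-1))_+, and likewise for cols_l(A); since weak dominance of
    partitions amounts to inequality of these sums for all thresholds, each of
    the conditions on rows and on columns is equivalent to the one on
    rectangles.

    For F-positivity, let p = l - 1 and q = k - 1. Removing from B the first p
    boxes of each row and then the first q remaining boxes of each column leaves
    exactly the south-east corners of k x l rectangles. The removed boxes form
    p vertical strips followed by q horizontal strips, so B has a standard
    tableau U in which the strips carry consecutive intervals of entries, every
    position inside a vertical strip is a descent, and no position inside a
    horizontal strip is. The fundamental quasisymmetric functions are linearly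
    independent, so A has a tableau T with the same descent set. In T a row
    meets each of the first p intervals at most once and a column meets each of
    the next q intervals at most once; hence the south-east corner of any k x l
    rectangle of A has an entry beyond all the strips, and there are only
    rects(B) such entries. *)

(** * Rows, columns and rectangles *)

Lemma geq_trans : transitive geq.
Proof. by move=> y x z xy yz; apply: leq_trans yz xy. Qed.

(** Termwise [x <= t + (x - t)] under truncated subtraction, with equality when [t <= x]. *)
Lemma excess_sum_ge (s : seq nat) t :
  (sumn s <= t * size s + sumn [seq x - t | x <- s])%N.
Proof. by elim: s => //= x s IH; lia. Qed.

Lemma excess_sum_eq (s : seq nat) t : all (leq t) s ->
  sumn s = (t * size s + sumn [seq x - t | x <- s])%N.
Proof. by elim: s => //= [_|x s IH /andP[tx /IH]]; lia. Qed.

Lemma excess_sum0 (s : seq nat) t : all (geq t) s ->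
  sumn [seq x - t | x <- s]%N = 0%N.
Proof. by elim: s => //= x s IH /andP[tx /IH]; lia. Qed.

Lemma excess_sum_take (s : seq nat) t n :
  (sumn [seq x - t | x <- take n s] <= sumn [seq x - t | x <- s])%N.
Proof.
rewrite -[X in (_ <= sumn (map _ X))%N](cat_take_drop n) map_cat sumn_cat.
exact: leq_addr.
Qed.

Lemma sorted_geq_split (s : seq nat) t : sorted geq s ->
  exists n, [/\ (n <= size s)%N, all (leq t.+1) (take n s) & all (geq t) (drop n s)].
Proof.
elim: s => [|x s IH] /=; first by exists 0%N.
move=> ps; have [n [ns h1 h2]] := IH (path_sorted ps).
case: (leqP x t) => xt; last by exists n.+1; rewrite /= xt h1.
exists 0%N; rewrite /= xt; split => //.
move: ps; rewrite path_sortedE; last exact: geq_trans.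
by case/andP => /allP h _; apply/allP => y /h yx; exact: leq_trans yx xt.
Qed.

Lemma sorted_geq_nth (s : seq nat) : sorted geq s ->
  forall i j, (i <= j)%N -> (nth 0 s j <= nth 0 s i)%N.
Proof.
move=> ss i j ij; case: (ltnP j (size s)) => js; last by rewrite nth_default.
by apply: (sorted_leq_nth geq_trans leqnn 0%N ss); rewrite ?inE ?(leq_ltn_trans ij).
Qed.

Lemma sorted_geq_take (s : seq nat) n : sorted geq s ->
  all (leq (nth 0%N s n)) (take n s) && all (geq (nth 0%N s n)) (drop n s).
Proof.
move=> /sorted_geq_nth sh.
apply/andP; split; apply/(all_nthP 0%N) => i /=.
  by rewrite size_take => hi; rewrite nth_take ?sh //; move: hi; case: ifP; lia.
by rewrite size_drop => hi; rewrite nth_drop sh //; lia.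
Qed.

(** Among the bounds [sumn (take n s) <= t * n + sumn [seq x - t | x <- s]], the one for [p] is an
    equality if [n] counts the parts of [p] above [t], and the one for [q] is an equality if [t] is
    the last part taken. The first choice gives the forward implication, the second the converse. *)
Lemma dominated_excess (p q : seq nat) : sorted geq p -> sorted geq q ->
  dominated p q <->
  forall t, (sumn [seq x - t | x <- p] <= sumn [seq x - t | x <- q])%N.
Proof.
move=> sp sq; split=> [dom t|h [//|n] /andP[_ np]].
  have [n [np h1 h2]] := sorted_geq_split t sp.
  rewrite -[X in (sumn (map _ X) <= _)%N](cat_take_drop n) map_cat sumn_cat.
  rewrite (excess_sum0 h2) addn0.
  have dn : (sumn (take n p) <= sumn (take n q))%N.
    by case: n np {h1 h2} => [|n] np; [rewrite !take0 | apply: dom].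
  have := @excess_sum_eq (take n p) t.
  have -> : all (leq t) (take n p) by apply: sub_all h1 => y; lia.
  move=> /(_ isT); rewrite size_takel // => e.
  have := excess_sum_ge (take n q) t; have := excess_sum_take q t n.
  have := size_take_min n q; nia.
have /andP[h1 h2] := sorted_geq_take n sq.
set t := nth 0%N q n in h1 h2; have := h t.
have := excess_sum_ge (take n.+1 p) t; have := excess_sum_take p t n.+1.
rewrite size_takel //.
have -> : sumn [seq x - t | x <- q]%N = sumn [seq x - t | x <- take n.+1 q]%N.
  rewrite -[in LHS](cat_take_drop n.+1 q) map_cat sumn_cat.
  rewrite [X in (_ + X)%N]excess_sum0 ?addn0 //.
  by move: h2; rewrite -add1n -drop_drop drop1; case: (drop n q) => //= a l /andP[].
case: (ltnP n (size q)) => nq.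
  have := @excess_sum_eq (take n.+1 q) t.
  rewrite (take_nth 0%N) // all_rcons h1 leqnn size_rcons size_takel ?(ltnW nq) //.
  by move=> /(_ isT); lia.
(* If [q] has at most [n] parts, the default value makes the threshold 0, and the excess sum of [q]
   is its full sum. *)
have -> : t = 0%N by rewrite /t nth_default.
by rewrite (map_id_in (s := take n.+1 q)) => [|x _]; [lia | rewrite subn0].
Qed.

(** * Counting rectangles by rows and by columns *)

Lemma count_interval a b n :
  count (fun x => a <= x < b)%N (iota 0 n) = (minn b n - a)%N.
Proof.
elim: n => [|n IH]; first by rewrite minn0.
by rewrite -addn1 iotaD count_cat IH /= add0n; lia.
Qed.

Lemma all_iota (P : pred nat) i k :
  reflect (forall x, (i <= x < i + k)%N -> P x) (all P (iota i k)).
Proof.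
by apply: (iffP allP) => h x hx; apply: h; move: hx; rewrite mem_iota.
Qed.

Definition convex (P : pred nat) :=
  forall x y z, (x <= y <= z)%N -> P x -> P z -> P y.

Lemma convex_interval (P : pred nat) n :
  convex P -> (forall x, P x -> (x < n)%N) ->
  exists a b, (b <= n)%N /\ P =1 (fun x => a <= x < b)%N.
Proof.
move=> cP bP; case: (boolP (has P (iota 0 n))) => [/hasP[x _ Px]|/hasPn nP].
  have exP : exists x, P x by exists x.
  have ubP y : P y -> (y <= n)%N by move/bP/ltnW.
  case: (ex_minnP exP) => a Pa amin; case: (ex_maxnP exP ubP) => b Pb bmax.
  exists a, b.+1; split=> [|y]; first exact: bP.
  apply/idP/idP => [Py|]; first by rewrite amin // ltnS bmax.
  by rewrite ltnS => aby; apply: (cP a y b).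
exists 0%N, 0%N; split=> // x; rewrite andbF; apply/negP => Px.
by have := nP x; rewrite mem_iota add0n bP // Px => /(_ isT).
Qed.

(** A convex bounded predicate is an interval [a <= x < b], and a window of length [l] fits in it
    exactly when its start lies in [a <= x < b - l.-1]. *)
Lemma count_windows (P : pred nat) n l : (0 < l)%N ->
  convex P -> (forall x, P x -> (x < n)%N) ->
  count (fun j => all P (iota j l)) (iota 0 n)
  = (count P (iota 0 n) - l.-1)%N.
Proof.
move=> l0 cP /(convex_interval cP)[a [b [bn Pab]]].
rewrite (eq_count Pab) count_interval.
rewrite (@eq_count _ _ (fun x => a <= x < b - l.-1)%N) => [|j].
  by rewrite count_interval; lia.
apply/all_iota/idP => [h|jb x jx]; last by rewrite Pab; lia.
by have := h j; have := h (j + l.-1)%N; rewrite !Pab; lia.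
Qed.

Section Grid.

Variables (f : nat -> nat -> bool) (r c : nat).

(* Convexity in the product order: the only property of a skew diagram that
   matters here, and one that is invariant under transposition. *)
Definition diagram :=
  [/\ forall i j i' j' x y, f i j -> f i' j' ->
        (i <= x <= i')%N -> (j <= y <= j')%N -> f x y,
      forall i j, f i j -> (i < r)%N
    & forall i j, f i j -> (j < c)%N].

Definition grid_rects k l : nat :=
  \sum_(i < r) \sum_(j < c) all (fun x => all (f x) (iota j l)) (iota i k).

Definition grid_rows k : seq nat :=
  part_of_seq [seq count (fun j => all (f^~ j) (iota i k)) (iota 0 c)
              | i <- iota 0 (r.+1 - k)].

Lemma sumn_part_excess t s :
  sumn [seq x - t | x <- part_of_seq s]%N = sumn [seq x - t | x <- s]%N.
Proof.
rewrite /part_of_seq !sumnE !big_map (perm_big _ (permEl (perm_sort _ _))) /=.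
rewrite big_filter [RHS](bigID (fun x => x != 0%N)) /=.
by rewrite [X in (_ = _ + X)%N]big1 ?addn0 // => i /negbNE/eqP->.
Qed.

(** The columns common to [k] consecutive rows form an interval, and the rectangles with these rows
    are its windows of length [l]. *)
Lemma grid_rows_excess k l : diagram -> (0 < k)%N -> (0 < l)%N ->
  sumn [seq x - l.-1 | x <- grid_rows k]%N = grid_rects k l.
Proof.
move=> [cf rf cf'] k0 l0.
rewrite sumn_part_excess sumnE !big_map /grid_rects.
rewrite -[in RHS](big_mkord xpredT (fun i => \sum_(j < c)
   all (fun x => all (f x) (iota j l)) (iota i k))%N).
have -> : iota 0 (r.+1 - k) = index_iota 0 (r.+1 - k) by rewrite /index_iota subn0.
have rw i : (count (fun j => all (f^~ j) (iota i k)) (iota 0 c) - l.-1)%N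
   = (\sum_(j < c) all (fun x => all (f x) (iota j l)) (iota i k))%N.
  rewrite -count_windows //.
  - rewrite -sum1_count big_mkcond /= -/(index_iota 0 c) -{1}(subn0 c) big_mkord.
    apply: eq_bigr => j _; rewrite -[RHS]/(nat_of_bool _); congr nat_of_bool.
    by apply/all_iota/all_iota => h x hx; apply/all_iota => y hy;
       move/all_iota: (h _ hy); apply.
  - move=> x y z xyz /all_iota hx /all_iota hz; apply/all_iota => i' hi.
    by apply: (cf i' x i' z); rewrite ?leqnn ?hx ?hz.
  - by move=> x /all_iota/(_ i) h; apply: cf' (h _); lia.
rewrite (eq_bigr _ (fun i _ => rw i)).
(* [grid_rects] also sums over top rows [i > r - k]; these contribute nothing, as row [i + k - 1] is
   outside the diagram. *)
have kr : (r.+1 - k <= r)%N by lia.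
rewrite [RHS](big_cat_nat _ kr) //= [X in (_ = _ + X)%N]big_nat_cond.
rewrite [X in (_ = _ + X)%N]big1 ?addn0 // => i hi; apply: big1 => j _.
apply/eqP; rewrite eqb0; apply/negP => /all_iota/(_ (i + k).-1) h.
have /all_iota/(_ j) h' : all (f (i + k).-1) (iota j l) by apply: h; lia.
have := rf (i + k).-1 j (h' _); lia.
Qed.

End Grid.

Lemma grid_rects_tr f r c k l :
  grid_rects (fun i j => f j i) c r l k = grid_rects f r c k l.
Proof.
rewrite /grid_rects exchange_big /=; apply: eq_bigr => i _; apply: eq_bigr => j _.
congr nat_of_bool; apply/all_iota/all_iota => h x hx; apply/all_iota => y hy;
  by move/all_iota: (h _ hy); apply.
Qed.

Lemma diagram_tr f r c : diagram f r c -> diagram (fun i j => f j i) c r.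
Proof.
case=> cf rf cf'; split=> [i j i' j' x y h h' hx hy|i j /cf'|i j /rf] //.
exact: cf h h' hy hx.
Qed.

Lemma skew_diagram A : diagram (in_skew A) (nrows A) (ncols A).
Proof.
have oA := sorted_geq_nth (proj2 (andP (outer_part A))).
have iA := sorted_geq_nth (proj2 (andP (inner_part A))).
split=> [i j i' j' x y|i j|i j]; rewrite /in_skew.
- move=> /andP[h _] /andP[_ h'] /andP[ix xi'] /andP[jy yj'].
  by have := oA _ _ xi'; have := iA _ _ ix; lia.
- by rewrite /nrows; case: (ltnP i (size (outer A))) => // h; rewrite (nth_default _ h); lia.
- by rewrite /ncols -nth0; have := oA 0%N i; lia.
Qed.

Lemma rectsE A k l : rects A k l = grid_rects (in_skew A) (nrows A) (ncols A) k l.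
Proof.
rewrite /rects /grid_rects pair_big /= -sum1dep_card big_mkcond /=.
by apply: eq_bigr => p _.
Qed.

Lemma rows_excess A k t : (0 < k)%N ->
  sumn [seq x - t | x <- rows_ A k]%N = rects A k t.+1.
Proof.
by move=> k0; rewrite rectsE -(grid_rows_excess (l := t.+1) (skew_diagram A)).
Qed.

(** The columns of [A] are the rows of the transposed diagram, so the row count applies again. *)
Lemma cols_excess A l t : (0 < l)%N ->
  sumn [seq x - t | x <- cols_ A l]%N = rects A t.+1 l.
Proof.
move=> l0; rewrite rectsE -grid_rects_tr.
by rewrite -(grid_rows_excess (l := t.+1) (diagram_tr (skew_diagram A))).
Qed.

Lemma part_of_seq_sorted s : sorted geq (part_of_seq s).
Proof. by apply: sort_sorted => x y; apply: leq_total. Qed.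

Lemma rows_rects A B : rows_cond A B <-> rects_cond A B.
Proof.
split=> h k.
  move=> [//|t] k0 _; have sA := part_of_seq_sorted; have := h k k0.
  by case/(dominated_excess (sA _) (sA _))/(_ t); rewrite !rows_excess.
move=> k0; apply/dominated_excess; try exact: part_of_seq_sorted.
by move=> t; rewrite !rows_excess // h.
Qed.

Lemma cols_rects A B : cols_cond A B <-> rects_cond A B.
Proof.
split=> h k.
  move=> l k0 l0; have sA := part_of_seq_sorted; have := h l l0.
  move=> /(dominated_excess (sA _) (sA _))/(_ k.-1).
  by rewrite !cols_excess // prednK.
move=> k0; apply/dominated_excess; try exact: part_of_seq_sorted.
by move=> t; rewrite !cols_excess // h.
Qed.

(** * Linear independence of the fundamental quasisymmetric functions *)

Lemma psums_pairmap x a :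
  pairmap (fun y z => z - y)%N x [seq x + sumn (take i a) | i <- iota 1 (size a)]%N = a.
Proof.
elim: a x => //= y a IH x; rewrite take0 /= addn0 addKn; congr cons.
rewrite -[RHS](IH (x + y)%N); congr pairmap.
rewrite (iotaDl 1 1) -map_comp; apply: eq_map => i /=;
  by rewrite add0n addnA.
Qed.

Lemma pairmap_psums x s : path leq x s ->
  [seq x + sumn (take i (pairmap (fun y z => z - y) x s)) | i <- iota 1 (size s)]%N = s.
Proof.
elim: s x => //= y s IH x /andP[xy ps]; rewrite take0 /= addn0 subnKC //; congr cons.
rewrite -[RHS](IH y ps) (iotaDl 1 1) -map_comp; apply: eq_map => i /=;
  by rewrite add0n addnA subnKC.
Qed.

(** [comp_set] omits the last partial sum, which is [sumn a]; [comp_of_set] appends it again before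
    taking differences. *)
Lemma comp_setK a : is_comp a -> comp_of_set (sumn a) (comp_set a) = a.
Proof.
case: a => [|x a] //= /andP[x0 _]; rewrite /comp_of_set.
have -> : (x + sumn a == 0)%N = false by lia.
rewrite -[RHS](psums_pairmap 0); congr pairmap; rewrite /comp_set [size _]/=.
rewrite (eq_map (g := fun i => 0 + sumn (take i (x :: a)))%N) //.
rewrite -[(size a).+1]addn1 iotaD map_cat /= ?add1n ?add0n take_oversize //=.
by rewrite addn1 cats1.
Qed.

Lemma pairmap_sub_path x s : path ltn x s ->
  is_comp (pairmap (fun y z => z - y)%N x s) /\
  (x + sumn (pairmap (fun y z => z - y) x s) = last x s)%N.
Proof.
elim: s x => [|y s IH] x /=; first by rewrite addn0.
by case/andP => xy /IH[h <-]; rewrite /is_comp /= -/(is_comp _) h; split; lia.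
Qed.

Lemma path_rcons_bound n ds : (0 < n)%N -> path ltn 0%N ds -> all (gtn n) ds ->
  path ltn 0%N (rcons ds n).
Proof.
move=> n0 pds dn; rewrite rcons_path pds /=.
by case/lastP: ds dn {pds} => // s y; rewrite all_rcons last_rcons => /andP[].
Qed.

Lemma is_comp_of_set n ds : path ltn 0%N ds -> all (gtn n) ds ->
  is_comp_of n (comp_of_set n ds).
Proof.
rewrite /comp_of_set; case: posnP => [->|n0] pds dn //.
have [h1] := pairmap_sub_path (path_rcons_bound n0 pds dn).
by rewrite add0n last_rcons /is_comp_of h1 => ->; rewrite eqxx.
Qed.

Lemma comp_of_setK n ds : path ltn 0%N ds -> all (gtn n) ds ->
  comp_set (comp_of_set n ds) = ds.
Proof.
rewrite /comp_of_set; case: posnP => [->|n0] pds dn; first by case: ds dn {pds}.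
have pr : path leq 0%N (rcons ds n).
  by apply: sub_path (path_rcons_bound n0 pds dn) => x y; apply: ltnW.
rewrite /comp_set size_pairmap size_rcons /=.
have := congr1 (take (size ds)) (pairmap_psums pr).
rewrite -map_take take_iota size_rcons (minn_idPl (leqnSn _)).
by rewrite -[X in take _ X]cats1 take_size_cat.
Qed.

Lemma comp_set_sorted a : is_comp a -> sorted ltn (comp_set a).
Proof.
move=> ca; rewrite /comp_set.
have h : all (fun i => i < size a)%N (iota 1 (size a).-1).
  by apply/allP => i; rewrite mem_iota; lia.
apply: (homo_sorted_in _ h (iota_ltn_sorted _ _)) => i j; rewrite !unfold_in => _ js ij.
rewrite -(cat_take_drop i (take j a)) take_takel ?(ltnW ij) // sumn_cat.
rewrite /= -[X in (X < _)%N]addn0 ltn_add2l.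
have : is_comp (drop i (take j a)) by apply/allP => y /mem_drop/mem_take/(allP ca).
have : (0 < size (drop i (take j a)))%N by rewrite size_drop size_takel; lia.
by case: (drop i (take j a)) => //= y s _ /andP[]; lia.
Qed.

(** The index condition under which [M_b] occurs in [F_a]: [b] is a refinement of [a]. *)
Definition refines (a b : seq nat) :=
  is_comp_of (sumn a) b && all [in comp_set b] (comp_set a).

Lemma size_comp_set a : size (comp_set a) = (size a).-1.
Proof. by rewrite size_map size_iota. Qed.

(** A composition is determined by its size and its set, and an inclusion of finite sets is an
    equality or raises the cardinality. Refinement is therefore triangular for the number of
    parts. *)
Lemma refines_size a b : is_comp a -> refines a b ->
  a = b \/ (size a < size b)%N.
Proof.
move=> ca /andP[/andP[cb /eqP sab] /allP sub].
have ua := sorted_uniq ltn_trans ltnn (comp_set_sorted ca).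
have := uniq_min_size ua sub; have := uniq_leq_size ua sub.
rewrite !size_comp_set => le h.
case: (ltnP (size a) (size b)) => ba; [by right|left].
have /h[_ e] : ((size b).-1 <= (size a).-1)%N by lia.
have e' : comp_set a = comp_set b.
  by apply: (irr_sorted_eq ltn_trans ltnn) => //; apply: comp_set_sorted.
by rewrite -(comp_setK ca) -(comp_setK cb) e' sab.
Qed.

Lemma refines_refl a : is_comp a -> refines a a.
Proof. by move=> ca; rewrite /refines /is_comp_of ca eqxx; apply/allP. Qed.

Lemma size_comp a : is_comp a -> (size a <= sumn a)%N.
Proof. by elim: a => //= x a IH /andP[x0 /IH]; rewrite /is_comp; lia. Qed.

Lemma leq_sumn (x : nat) a : x \in a -> (x <= sumn a)%N.
Proof. by elim: a => //= y a IH; rewrite inE => /orP[/eqP->|/IH]; lia. Qed.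

(** A monomial occurs in a single [M_b], namely the one with [b = exponents m]. *)
Lemma fundamental_qsymE a m : fundamental_qsym a m = (refines a (exponents m))%:R.
Proof.
rewrite /fundamental_qsym; set n := sumn a.
case: (boolP (refines a (exponents m))) => [/andP[cm sm]|nr]; last first.
  apply: big1 => b hb; rewrite /monomial_qsym; case: eqP => // e.
  by case/negP: nr; rewrite /refines e.
have [ce /eqP se] := andP cm.
(* The exponents are repackaged as an element of the bounded index type of the sum. *)
have sz : (size [seq (inord x : 'I_n.+1) | x <- exponents m] <= n)%N.
  by rewrite size_map -[n]se size_comp.
have e : map val (Bseq sz) = exponents m.
  rewrite -map_comp map_id_in // => x xe /=; rewrite inordK // ltnS.
  by rewrite -[n]se leq_sumn.
rewrite (bigD1 (Bseq sz)) /= ?e; last by rewrite cm.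
rewrite big1 => [|b /andP[_ nb]]; first by rewrite addr0 /monomial_qsym eqxx.
rewrite /monomial_qsym -e; case: eqP => // /(inj_map val_inj) eb.
by case/eqP: nb; apply: val_inj.
Qed.

Lemma exponents_onto a : is_comp a -> exists m, exponents m = a.
Proof.
move=> ca; set S := [fset i in iota 0 (size a)]%fset.
pose m : {cmonom nat} := CMonom [fsfun i in S => nth 0%N a i | 0%N].
have inS i : (i \in S) = (i < size a)%N by rewrite !inE /= mem_iota.
have mE i : m i = nth 0%N a i.
  by rewrite /m /= fsfunE inS; case: ltnP => // h; rewrite nth_default.
exists m; rewrite /exponents (_ : sort leq (finsupp m) = iota 0 (size a)).
  apply: (@eq_from_nth _ 0%N) => [|i]; rewrite size_map size_iota // => hi.
  by rewrite (nth_map 0%N) ?size_iota // nth_iota // mE.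
apply: (irr_sorted_eq ltn_trans ltnn); rewrite ?iota_ltn_sorted //.
  by rewrite ltn_sorted_uniq_leq sort_uniq fset_uniq sort_sorted //; apply: leq_total.
move=> i; rewrite mem_sort mem_finsupp mE mem_iota /=.
case: (ltnP i (size a)) => h; last by rewrite nth_default.
by rewrite -lt0n (allP ca) // mem_nth.
Qed.

(** Strong induction on the number of parts. At a monomial with exponents [a], only [F_a] and some
    [F_b] with [b] shorter than [a] are nonzero, and the coefficients of the latter vanish by
    induction. *)
Lemma fundamental_qsym_free (L : seq (seq nat)) (d : seq nat -> rat) :
  uniq L -> all is_comp L ->
  (forall m, \sum_(a <- L) d a * fundamental_qsym a m = 0) ->
  {in L, forall a, d a = 0}.
Proof.
move=> uL /allP cL sum0 a; have [n] := ubnP (size a).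
elim: n a => // n IH a an aL; have [m em] := exponents_onto (cL a aL).
have := sum0 m; rewrite (bigD1_seq a) //= big_seq_cond big1.
  by rewrite fundamental_qsymE em refines_refl ?cL // mulr1 addr0.
move=> b /andP[bL ba]; rewrite fundamental_qsymE em.
case: (boolP (refines b a)) => [/(refines_size (cL b bL))[e|ab]|]; last by rewrite mulr0.
  by rewrite e eqxx in ba.
by rewrite (IH b) ?mul0r //; apply: leq_trans ab _.
Qed.

(** * Descent compositions and F-positivity *)

Lemma descents_path A (T : filling A) :
  path ltn 0%N (descents T) /\ all (gtn (nboxes A)) (descents T).
Proof.
split; rewrite /descents.
  rewrite path_sortedE; last exact: ltn_trans.
  rewrite sorted_filter ?iota_ltn_sorted //; last exact: ltn_trans.
  by rewrite andbT; apply/allP => i; rewrite mem_filter mem_iota => /and3P[].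
by apply/allP => i; rewrite mem_filter mem_iota => /and3P[_ /= h1 h2]; lia.
Qed.

Lemma descent_comp_of A (T : filling A) : is_comp_of (nboxes A) (descent_comp T).
Proof. by have [h1 h2] := descents_path T; apply: is_comp_of_set. Qed.

Lemma descent_comp_inj A B (T : filling A) (U : filling B) :
  descent_comp T = descent_comp U ->
  nboxes A = nboxes B /\ descents T = descents U.
Proof.
move=> e; split.
  have /andP[_ /eqP <-] := descent_comp_of T; rewrite e.
  by have /andP[_ /eqP] := descent_comp_of U.
have [h1 h2] := descents_path T; have [h3 h4] := descents_path U.
by rewrite -(comp_of_setK h1 h2) -(comp_of_setK h3 h4); congr comp_set.
Qed.

Lemma skew_schur_multiplicity A (L : seq (seq nat)) m : uniq L ->
  (forall T : filling A, descent_comp T \in L) ->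
  skew_schur A m =
  \sum_(a <- L) (\sum_(T : filling A | is_syt T) (descent_comp T == a)%:R)
                * fundamental_qsym a m.
Proof.
move=> uL inL; under eq_bigr do rewrite mulr_suml.
rewrite exchange_big; apply: eq_bigr => T _ /=.
rewrite (bigD1_seq (descent_comp T)) //= eqxx mul1r big1 ?addr0 // => a.
by rewrite eq_sym => /negPf->; rewrite mul0r.
Qed.

(** By linear independence, the multiplicity of a descent composition in [A] minus that in [B] is a
    coefficient of the [F]-expansion, hence nonnegative; the multiplicity in [B] is at least 1
    because of [U]. *)
Lemma F_positive_descents A B (U : filling B) :
  F_positive (skew_schur A \- skew_schur B) -> is_syt U ->
  exists2 T : filling A, is_syt T & descent_comp T = descent_comp U.
Proof.
case=> c [cc cE] c0 sU.
pose mult C a : rat := \sum_(T : filling C | is_syt T) (descent_comp T == a)%:R.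
(* A common index list for both Schur expansions and the support of [c]. *)
pose L := undup ([seq descent_comp T | T : filling A]
  ++ [seq descent_comp T | T : filling B] ++ finsupp c).
have uL : uniq L by apply: undup_uniq.
have AL (T : filling A) : descent_comp T \in L.
  by rewrite mem_undup !mem_cat image_f.
have BL (T : filling B) : descent_comp T \in L.
  by rewrite mem_undup !mem_cat image_f ?orbT.
have cL : all is_comp L.
  apply/allP => a; rewrite mem_undup !mem_cat => /or3P[/imageP[T _ ->]|/imageP[T _ ->]|/cc //].
    by have /andP[] := descent_comp_of T.
  by have /andP[] := descent_comp_of T.
have d0 : mult A (descent_comp U) - mult B (descent_comp U) - c (descent_comp U) = 0.
  apply: (fundamental_qsym_free (d := fun a => mult A a - mult B a - c a) uL cL) => // m.
  under eq_bigr do rewrite !mulrBl.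
  rewrite !sumrB -!skew_schur_multiplicity //; apply/eqP; rewrite subr_eq0; apply/eqP.
  rewrite -[LHS]/((skew_schur A \- skew_schur B) m) cE.
  rewrite [RHS](bigID [in finsupp c]) /= [X in _ = _ + X]big1 ?addr0.
    rewrite -[RHS]big_filter; apply: perm_big; apply: uniq_perm; rewrite ?filter_uniq ?fset_uniq //.
    by move=> a; rewrite mem_filter mem_undup !mem_cat; case: (a \in finsupp c); rewrite ?orbT.
  by move=> a ac; rewrite fsfun_dflt // mul0r.
case: (pickP (fun T : filling A => is_syt T && (descent_comp T == descent_comp U))).
  by move=> T /andP[sT /eqP e]; exists T.
move=> no; have A0 : mult A (descent_comp U) = 0.
  by apply: big1 => T sT; have := no T; rewrite sT /= => ->.
have B1 : 1 <= mult B (descent_comp U).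
  rewrite /mult (bigD1 U) //= eqxx lerDl; apply: sumr_ge0 => T _; exact: ler0n.
have := c0 (descent_comp U); move: d0; rewrite A0 => d0 cU; exfalso.
by move: (lt_le_trans ltr01 B1); lra.
Qed.

(** * Strips in a diagram *)

Lemma count_iota_le (P Q : pred nat) m n : (m <= n)%N ->
  (forall y, (y < m)%N -> P y -> Q y) ->
  (count P (iota 0 m) <= count Q (iota 0 n))%N.
Proof.
move=> mn PQ; rewrite -(subnKC mn) iotaD count_cat.
apply: leq_trans (leq_addr _ _); rewrite -!size_filter.
apply: uniq_leq_size; first by rewrite filter_uniq // iota_uniq.
by move=> y; rewrite !mem_filter !mem_iota => /andP[Py /= hy]; rewrite PQ.
Qed.

Section Blocks.

Variables (f : nat -> nat -> bool) (r c : nat).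
Hypothesis fD : diagram f r c.

Definition left_count i j := count (f i) (iota 0 j).

(** By convexity, every box of row [i] to the left of column [j] has a box of row [i'] in its own
    column. *)
Lemma left_count_le i j i' j' : f i j -> f i' j' ->
  (i <= i')%N -> (j <= j')%N -> (left_count i j <= left_count i' j')%N.
Proof.
case: fD => cf _ _ h h' ii jj; apply: count_iota_le => // y yj fy.
by apply: cf fy h' _ _; rewrite ?ii ?leqnn //=; lia.
Qed.

Lemma left_count_lt i j i' j' : f i j -> f i' j' ->
  (i <= i')%N -> (j < j')%N -> (left_count i j < left_count i' j')%N.
Proof.
case: (fD) => cf _ _ h h' ii jj.
have hj : f i' j by apply: cf h h' _ _; rewrite ?ii ?leqnn //= ltnW.
have := left_count_le h hj ii (leqnn _).
have : (left_count i' j.+1 <= left_count i' j')%N by apply: count_iota_le.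
by rewrite /left_count -addn1 iotaD count_cat /= add0n hj; lia.
Qed.

(** Pigeonhole: for [n > 0], the [n - 1] columns just before [j] cannot hold all [n] boxes. *)
Lemma left_count_witness n i j : f i j -> (n <= left_count i j)%N ->
  (n <= j)%N /\ exists2 y, (y <= j - n)%N & f i y.
Proof.
case: n => [|n] h hn; first by split=> //; exists j; rewrite ?subn0.
have nj : (n < j)%N.
  by apply: leq_trans hn _; rewrite -[X in (_ <= X)%N](size_iota 0) count_size.
split=> //; have : has (f i) (iota 0 (j - n)).
  rewrite has_count; move: hn; rewrite /left_count -{1}(subnK (ltnW nj)) iotaD count_cat.
  by have := count_size (f i) (iota (0 + (j - n)) n); rewrite size_iota; lia.
by case/hasP=> y; rewrite mem_iota => hy fy; exists y => //; lia.
Qed.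

End Blocks.

Lemma mixed_radix_lt c i j i' j' : (j < c)%N -> (j' < c)%N ->
  (i * c + j < i' * c + j')%N = (i < i')%N || (i == i') && (j < j')%N.
Proof.
move=> hj hj'; case: (ltngtP i i') => [h|h|->] /=; last by rewrite ltn_add2l.
  by have := leq_mul h (leqnn c); rewrite mulSn; lia.
by have := leq_mul h (leqnn c); rewrite mulSn; lia.
Qed.

Lemma mixed_radix_inj c i j i' j' : (j < c)%N -> (j' < c)%N ->
  (i * c + j = i' * c + j')%N -> i = i' /\ j = j'.
Proof.
move=> hj hj' e; have := mixed_radix_lt i i' hj hj'; have := mixed_radix_lt i' i hj' hj.
by rewrite e ltnn; case: (ltngtP i i') => //= -> ; lia.
Qed.

Section Strips.

Variables (f : nat -> nat -> bool) (r c p q : nat).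
Hypothesis fD : diagram f r c.

Definition beyond_vertical i j := f i j && (p <= left_count f i j)%N.

Lemma beyond_vertical_diagram : diagram beyond_vertical r c.
Proof.
case: (fD) => cf rf cf'; split=> [i j i' j' x y|i j|i j]; rewrite /beyond_vertical.
- move=> /andP[h hp] /andP[h' _] hx hy.
  have fxy := cf _ _ _ _ _ _ h h' hx hy; rewrite fxy /=.
  by apply: leq_trans hp (left_count_le fD h fxy _ _); lia.
- by case/andP => /rf.
- by case/andP => /cf'.
Qed.

(** Transposition turns [left_count] into the number of remaining boxes above row [i] in column
    [j]. *)
Definition up_count i j := left_count (fun y x => beyond_vertical x y) j i.

Lemma up_count_le i j i' j' : beyond_vertical i j -> beyond_vertical i' j' ->
  (i <= i')%N -> (j <= j')%N -> (up_count i j <= up_count i' j')%N.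
Proof.
by move=> h h' ii jj; apply: (left_count_le (diagram_tr beyond_vertical_diagram)).
Qed.

Lemma up_count_lt i j i' j' : beyond_vertical i j -> beyond_vertical i' j' ->
  (i < i')%N -> (j <= j')%N -> (up_count i j < up_count i' j')%N.
Proof.
by move=> h h' ii jj; apply: (left_count_lt (diagram_tr beyond_vertical_diagram)).
Qed.

(* Blocks 0, ..., p-1 are vertical strips made of the first p boxes of each
   row; blocks p, ..., p+q-1 are horizontal strips made of the next q boxes of
   each column; block p+q is the rest. *)
Definition block i j :=
  if (left_count f i j < p)%N then left_count f i j
  else (p + minn q (up_count i j))%N.

(** Horizontal strips are read column by column, which avoids descents; the other blocks are read
    row by row, which makes every step inside a vertical strip a descent. *)
Definition block_pos i j :=
  if (p <= block i j < p + q)%N then (j * r + i)%N else (i * c + j)%N.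

(** A lexicographic key: the block is the leading digit in base [r * c], the position within the
    block the last digit. *)
Definition block_key i j := (block i j * (r * c) + block_pos i j)%N.

Lemma block_le i j i' j' : f i j -> f i' j' ->
  (i <= i')%N -> (j <= j')%N -> (block i j <= block i' j')%N.
Proof.
move=> h h' ii jj; have := left_count_le fD h h' ii jj; rewrite /block.
case: (ltnP _ p) => hp; case: (ltnP _ p) => hp'; try lia.
have g : beyond_vertical i j by rewrite /beyond_vertical h.
have g' : beyond_vertical i' j' by rewrite /beyond_vertical h'.
by have := up_count_le g g' ii jj; lia.
Qed.

Lemma block_row_lt i j j' : f i j -> f i j' -> (j < j')%N ->
  (block i j < p)%N -> (block i j < block i j')%N.
Proof.
move=> h h' jj; have := left_count_lt fD h h' (leqnn i) jj; rewrite /block.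
by case: (ltnP (left_count f i j) p); case: (ltnP (left_count f i j') p); lia.
Qed.

(** Below [p + q] the minimum with [q] is not attained by [q], so strict growth of [up_count]
    carries over. Different columns are allowed because [horizontal_block] compares arbitrary boxes
    of a strip. *)
Lemma block_se_lt i j i' j' : f i j -> f i' j' -> (i < i')%N -> (j <= j')%N ->
  (p <= block i j < p + q)%N -> (block i j < block i' j')%N.
Proof.
move=> h h' ii jj; have := left_count_le fD h h' (ltnW ii) jj; rewrite /block.
case: (ltnP (left_count f i j) p) => hp; case: (ltnP (left_count f i' j') p) => hp'; try lia.
have g : beyond_vertical i j by rewrite /beyond_vertical h.
have g' : beyond_vertical i' j' by rewrite /beyond_vertical h'.
by have := up_count_lt g g' ii jj; lia.
Qed.

Lemma block_pos_lt i j : f i j -> (block_pos i j < r * c)%N.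
Proof.
case: fD => _ rf cf h; have := rf _ _ h; have := cf _ _ h; rewrite /block_pos.
by case: ifP => _; nia.
Qed.

Lemma block_key_lt i j i' j' : f i j -> f i' j' ->
  (block_key i j < block_key i' j')%N =
  (block i j < block i' j')%N ||
  (block i j == block i' j') && (block_pos i j < block_pos i' j')%N.
Proof. by move=> h h'; rewrite mixed_radix_lt // block_pos_lt. Qed.

Lemma block_key_inj i j i' j' : f i j -> f i' j' ->
  block_key i j = block_key i' j' -> i = i' /\ j = j'.
Proof.
move=> h h' /mixed_radix_inj[]; rewrite ?block_pos_lt // /block_pos => ->.
case: fD => _ rf cf; case: ifP => _ /mixed_radix_inj[] //; try exact: cf; try exact: rf.
- exact: rf h.
- exact: rf h'.
- exact: cf h.
- exact: cf h'.
Qed.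

Lemma block_key_row i j j' : f i j -> f i j' -> (j < j')%N ->
  (block_key i j < block_key i j')%N.
Proof.
move=> h h' jj; rewrite block_key_lt //; have := block_le h h' (leqnn i) (ltnW jj).
case: ltngtP => //= e _; rewrite /block_pos e; case: ifP => _; last by lia.
by rewrite ltn_add2r ltn_mul2r jj; case: fD => _ /(_ _ _ h); lia.
Qed.

Lemma block_key_col i i' j : f i j -> f i' j -> (i < i')%N ->
  (block_key i j < block_key i' j)%N.
Proof.
move=> h h' ii; rewrite block_key_lt //; have := block_le h h' (ltnW ii) (leqnn j).
case: ltngtP => //= e _; rewrite /block_pos -e; case: ifP => [hb|_].
  by have := block_se_lt h h' ii (leqnn j) hb; rewrite e ltnn.
by rewrite ltn_add2r ltn_mul2r ii; case: fD => _ _ /(_ _ _ h); lia.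
Qed.

(** Reading by rows leaves only the case of two boxes in one row, which a vertical strip
    excludes. *)
Lemma vertical_block i j i' j' : f i j -> f i' j' ->
  (block_key i j < block_key i' j')%N -> block i j = block i' j' ->
  (block i j < p)%N -> (i < i')%N.
Proof.
move=> h h'; rewrite block_key_lt // => + e hp; rewrite e ltnn eqxx /= /block_pos -e.
have -> : (p <= block i j < p + q)%N = false by lia.
case: fD => _ _ cf; rewrite mixed_radix_lt ?(cf _ _ h) ?(cf _ _ h') //.
case/orP => // /andP[/eqP ei jj]; subst i'.
by have := block_row_lt h h' jj hp; rewrite e ltnn.
Qed.

(** Reading by columns puts the later box weakly to the right; were it also strictly lower, it would
    lie in a later block. *)
Lemma horizontal_block i j i' j' : f i j -> f i' j' ->
  (block_key i j < block_key i' j')%N -> block i j = block i' j' ->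
  (p <= block i j < p + q)%N -> (i' <= i)%N.
Proof.
move=> h h'; rewrite block_key_lt // => + e hp; rewrite e ltnn eqxx /= /block_pos -e hp.
case: (fD) => _ rf _; rewrite mixed_radix_lt ?(rf _ _ h) ?(rf _ _ h') // => hj.
case: (leqP i' i) => // ii.
have jj : (j <= j')%N by move: hj; lia.
by have := block_se_lt h h' ii jj hp; rewrite e ltnn.
Qed.

Lemma last_block i j : f i j -> (p + q <= block i j)%N ->
  [/\ (q <= i)%N, (p <= j)%N &
    forall x y, (i - q <= x <= i)%N -> (j - p <= y <= j)%N -> f x y].
Proof.
move=> h; rewrite /block; case: (ltnP (left_count f i j) p) => hp hb; first by lia.
have gij : beyond_vertical i j by rewrite /beyond_vertical h.
(* First climb [q] rows within the remaining boxes, then go [p] columns left in the row reached;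
   convexity fills the rectangle between that box and [(i, j)]. *)
have [|qi [i0 hi0]] := @left_count_witness (fun y x => beyond_vertical x y) q j i gij.
  by rewrite -/(up_count i j); lia.
case/andP => h0 hp0; have [pj [j0 hj0 f0]] := left_count_witness h0 hp0.
split=> // x y hx hy; case: fD => cf _ _.
by apply: cf f0 h _ _; lia.
Qed.

End Strips.

(** * Tableaux *)

Section Boxes.

Variable A : skew_shape.

Lemma in_skew_box (b : box A) : in_skew A (brow b) (bcol b).
Proof. exact: (svalP b). Qed.

Lemma box_at i j : in_skew A i j -> exists b : box A, brow b = i /\ bcol b = j.
Proof.
move=> h; case: (skew_diagram A) => _ /(_ _ _ h) hi /(_ _ _ h) hj.
by exists (exist _ (Ordinal hi, Ordinal hj) h).
Qed.

Lemma box_inj (b b' : box A) : brow b = brow b' -> bcol b = bcol b' -> b = b'.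
Proof.
case: b b' => [[i j] h] [[i' j'] h'] /= ei ej; apply: val_inj => /=.
by congr pair; apply: val_inj.
Qed.

(** Standardization: each box receives its rank for [K], that is, the number of boxes with smaller
    key. *)
Lemma syt_of_key (K : box A -> nat) : injective K ->
  (forall b b', brow b = brow b' -> (bcol b < bcol b')%N -> (K b < K b')%N) ->
  (forall b b', bcol b = bcol b' -> (brow b < brow b')%N -> (K b < K b')%N) ->
  exists2 T : filling A, is_syt T &
    forall b b', (entry T b < entry T b')%N = (K b < K b')%N.
Proof.
move=> Kinj Krow Kcol.
pose below b := [set b' | (K b' < K b)%N].
have rk b : (#|below b| < nboxes A)%N.
  rewrite /nboxes -cardsT; apply: proper_card.
  by apply/properP; split; [apply: subsetT | exists b; rewrite ?inE ?ltnn].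
pose T : filling A := [ffun b => Ordinal (rk b)].
have ordT b b' : (entry T b < entry T b')%N = (K b < K b')%N.
  rewrite /entry !ffunE ltnS /=; case: (ltnP (K b) (K b')) => h.
    apply: proper_card; apply/properP; split.
      by apply/subsetP => x; rewrite !inE => /ltn_trans; apply.
    by exists b; rewrite !inE ?ltnn.
  apply/negbTE; rewrite -leqNgt; apply: subset_leq_card.
  by apply/subsetP => x; rewrite !inE => /leq_trans; apply.
exists T => //; apply/and3P; split.
- apply/injectiveP => b b' e; apply: Kinj; apply/eqP.
  by have := ordT b b'; have := ordT b' b; rewrite /entry e ltnn; lia.
- apply/forallP => b; apply/forallP => b'; apply/implyP => /andP[/eqP h h'].
  by rewrite ordT Krow.
- apply/forallP => b; apply/forallP => b'; apply/implyP => /andP[/eqP h h'].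
  by rewrite ordT Kcol.
Qed.

(* Meaningful when [q <= brow b] and [p <= bcol b]; otherwise the subtractions
   truncate. *)
Definition nw_corner p q (b : box A) : 'I_(nrows A) * 'I_(ncols A) :=
  (Ordinal (leq_ltn_trans (leq_subr q _) (ltn_ord (sval b).1)),
   Ordinal (leq_ltn_trans (leq_subr p _) (ltn_ord (sval b).2))).

Section Tableau.

Variables (T : filling A).
Hypothesis sT : is_syt T.

Lemma syt_row b b' : brow b = brow b' -> (bcol b < bcol b')%N ->
  (entry T b < entry T b')%N.
Proof.
case/and3P: sT => _ /forallP/(_ b)/forallP/(_ b')/implyP + _ => h e h'.
by apply: h; rewrite e eqxx.
Qed.

Lemma syt_col b b' : bcol b = bcol b' -> (brow b < brow b')%N ->
  (entry T b < entry T b')%N.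
Proof.
case/and3P: sT => _ _ /forallP/(_ b)/forallP/(_ b')/implyP h e h'.
by apply: h; rewrite e eqxx.
Qed.

Lemma entry_inj : injective (entry T).
Proof.
case/and3P: sT => /injectiveP Tinj _ _ b b' [e].
by apply: Tinj; apply: val_inj.
Qed.

Lemma entry_bounds b : (0 < entry T b <= nboxes A)%N.
Proof. exact: (ltn_ord (T b)). Qed.

Lemma entry_onto v : (0 < v <= nboxes A)%N -> exists b, entry T b = v.
Proof.
case: v => // v hv; case/and3P: sT => /injectiveP Tinj _ _.
have := inj_card_onto Tinj; rewrite card_ord => /(_ (leqnn _) (Ordinal hv)).
by case/codomP => b e; exists b; rewrite /entry -e.
Qed.

Lemma mem_descents b b' : entry T b' = (entry T b).+1 ->
  (entry T b \in descents T) = (brow b < brow b')%N.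
Proof.
move=> e; rewrite /descents mem_filter mem_iota.
have hb := entry_bounds b; have hb' := entry_bounds b'.
have -> : (0 < entry T b < 1 + (nboxes A).-1)%N by lia.
rewrite andbT; apply/existsP/idP => [[x /existsP[x' /and3P[/eqP ex /eqP ex']]]|h].
  by rewrite (entry_inj ex) (@entry_inj x' b') // ex' e.
by exists b; apply/existsP; exists b'; rewrite e !eqxx.
Qed.

Lemma descent_run b b' : (entry T b < entry T b')%N ->
  (forall u, (entry T b <= u < entry T b')%N -> u \in descents T) ->
  (brow b < brow b')%N.
Proof.
(* Induction on the gap between the two entries, peeling off the box [x] whose entry precedes that
   of [b']. *)
move: {2}(entry T b' - entry T b)%N (erefl (entry T b' - entry T b)%N) => n.
elim: n b' => [|n IH] b' en bb run; first by lia.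
have [|x ex] := @entry_onto (entry T b').-1; first by
  have := entry_bounds b; have := entry_bounds b'; lia.
have xb : (brow x < brow b')%N by rewrite -mem_descents ?run ?ex; lia.
case: (ltngtP (entry T b) (entry T x)) => h; first 1 last; [by lia| |].
  by rewrite (entry_inj h).
by apply: leq_trans xb; apply: ltnW; apply: IH => // [|u hu]; [lia|apply: run; lia].
Qed.

Lemma nondescent_run b b' : (entry T b < entry T b')%N ->
  (forall u, (entry T b <= u < entry T b')%N -> u \notin descents T) ->
  (brow b' <= brow b)%N.
Proof.
move: {2}(entry T b' - entry T b)%N (erefl (entry T b' - entry T b)%N) => n.
elim: n b' => [|n IH] b' en bb run; first by lia.
have [|x ex] := @entry_onto (entry T b').-1; first by
  have := entry_bounds b; have := entry_bounds b'; lia.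
have xb : (brow b' <= brow x)%N by rewrite leqNgt -mem_descents ?run ?ex; lia.
case: (ltngtP (entry T b) (entry T x)) => h; first 1 last; [by lia| |].
  by rewrite (entry_inj h).
by apply: leq_trans xb _; apply: IH => // [|u hu]; [lia|apply: run; lia].
Qed.

(** * Block labels on the entries of a tableau *)

Section BlockLabels.

(** Labels sit on entries rather than boxes, so the hypotheses involve only the number of boxes and
    the descent set and pass to any tableau sharing both. *)
Variables (p q : nat) (bl : nat -> nat).
Hypothesis bl_le : forall v w, (0 < v <= w)%N -> (w <= nboxes A)%N -> (bl v <= bl w)%N.
Hypothesis bl_des : forall v, (0 < v < nboxes A)%N -> bl v = bl v.+1 ->
  (bl v < p)%N -> v \in descents T.
Hypothesis bl_nondes : forall v, (0 < v < nboxes A)%N -> bl v = bl v.+1 ->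
  (p <= bl v < p + q)%N -> v \notin descents T.

Lemma block_const b b' u : bl (entry T b) = bl (entry T b') ->
  (entry T b <= u < entry T b')%N ->
  [/\ (0 < u < nboxes A)%N, bl u = bl (entry T b) & bl u = bl u.+1].
Proof.
move=> e hu; have hb := entry_bounds b; have hb' := entry_bounds b'.
have h0 : (0 < u < nboxes A)%N by lia.
have h1 := @bl_le (entry T b) u; have h2 := @bl_le u u.+1.
by have h3 := @bl_le u.+1 (entry T b'); split; lia.
Qed.

(** Equal labels would make every entry from that of [b] up to the one before that of [b'] a
    descent, so [b'] would lie strictly lower than [b]. *)
Lemma label_row_lt (b b' : box A) : brow b = brow b' -> (bcol b < bcol b')%N ->
  (bl (entry T b) < p)%N -> (bl (entry T b) < bl (entry T b'))%N.
Proof.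
move=> er hc hp; have he := syt_row er hc.
have hb := entry_bounds b; have hb' := entry_bounds b'.
rewrite ltn_neqAle bl_le ?andbT; try lia; apply/eqP => e.
have := @descent_run b b' he; rewrite er ltnn => h.
suff: false by []; apply: h => u /(block_const e)[h0 h1 h2].
by apply: bl_des => //; rewrite h1.
Qed.

Lemma label_col_lt (b b' : box A) : bcol b = bcol b' -> (brow b < brow b')%N ->
  (p <= bl (entry T b) < p + q)%N -> (bl (entry T b) < bl (entry T b'))%N.
Proof.
move=> er hc hp; have he := syt_col er hc.
have hb := entry_bounds b; have hb' := entry_bounds b'.
rewrite ltn_neqAle bl_le ?andbT; try lia; apply/eqP => e.
have := @nondescent_run b b' he; rewrite leqNgt hc => h.
suff: false by []; apply: h => u /(block_const e)[h0 h1 h2].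
by apply: bl_nondes => //; rewrite h1.
Qed.

(** Each step to the right raises the label until it reaches [p], after which monotonicity keeps it
    there. *)
Lemma label_row_ge t (b b' : box A) : brow b = brow b' -> bcol b' = (bcol b + t)%N ->
  (minn t p <= bl (entry T b'))%N.
Proof.
elim: t b' => [|t IH] b' er ec; first by rewrite min0n.
have [x [xr xc]] : exists x : box A, brow x = brow b /\ bcol x = (bcol b + t)%N.
  apply: box_at; case: (skew_diagram A) => cf _ _.
  by apply: cf (in_skew_box b) (in_skew_box b') _ _; lia.
have := IH x (esym xr) xc; have := @label_row_lt x b'.
have := @bl_le (entry T x) (entry T b'); have := @syt_row x b'.
by have := entry_bounds x; have := entry_bounds b'; lia.
Qed.

Lemma label_col_ge t (b b' : box A) : bcol b = bcol b' -> brow b' = (brow b + t)%N ->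
  (p <= bl (entry T b))%N -> (p + minn t q <= bl (entry T b'))%N.
Proof.
move=> + + hp; elim: t b' => [|t IH] b' ec er.
  by rewrite min0n addn0 (@box_inj b' b) //; lia.
have [x [xr xc]] : exists x : box A, brow x = (brow b + t)%N /\ bcol x = bcol b.
  apply: box_at; case: (skew_diagram A) => cf _ _.
  by apply: cf (in_skew_box b) (in_skew_box b') _ _; lia.
have := IH x (esym xc) xr; have := @label_col_lt x b'.
have := @bl_le (entry T x) (entry T b'); have := @syt_col x b'.
by have := entry_bounds x; have := entry_bounds b'; lia.
Qed.

Lemma rects_le_labels :
  (rects A q.+1 p.+1 <= count (fun v => p + q <= bl v)%N (iota 1 (nboxes A)))%N.
Proof.
pose S := [set b : box A | (p + q <= bl (entry T b))%N].
apply: (@leq_trans #|S|).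
  (* Every rectangle is recovered from its south-east corner [b2]; the label is at least [p] at the
     north-east corner [b1] and at least [p + q] at [b2]. *)
  apply: leq_trans (leq_imset_card (nw_corner p q) (mem S)).
  apply: subset_leq_card; apply/subsetP => -[i j]; rewrite inE => /all_iota h.
  have h' x y : (i <= x <= i + q)%N -> (j <= y <= j + p)%N -> in_skew A x y.
    move=> hx hy; have /all_iota rowx : all (in_skew A x) (iota j p.+1) by apply: h => /=; lia.
    by apply: rowx; lia.
  have [|b0 [r0 c0]] := @box_at i j; first by apply: h'; lia.
  have [|b1 [r1 c1]] := @box_at i (j + p); first by apply: h'; lia.
  have [|b2 [r2 c2]] := @box_at (i + q) (j + p); first by apply: h'; lia.
  have hb1 : (p <= bl (entry T b1))%N.
    by rewrite -{1}(minnn p); apply: (label_row_ge (b := b0)); lia.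
  have hb2 : (p + q <= bl (entry T b2))%N.
    by rewrite -{1}(minnn q); apply: (label_col_ge (b := b1)); lia.
  apply/imsetP; exists b2; first by rewrite inE.
  move: r2 c2; rewrite /brow /bcol => r2 c2.
  by congr pair; apply: val_inj; rewrite /= ?r2 ?c2 addnK.
rewrite cardE -(size_map (entry T)) -size_filter; apply: uniq_leq_size.
  by rewrite map_inj_uniq ?enum_uniq //; apply: entry_inj.
move=> v /mapP[b]; rewrite mem_enum inE => hb ->.
by rewrite mem_filter hb mem_iota; have := entry_bounds b; lia.
Qed.

End BlockLabels.

End Tableau.

End Boxes.

(** * The strip tableau and the comparison of the two shapes *)

Lemma strip_tableau B p q : exists2 U : filling B, is_syt U &
  exists bl : nat -> nat,
  [/\ forall v w, (0 < v <= w)%N -> (w <= nboxes B)%N -> (bl v <= bl w)%N,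
      forall v, (0 < v < nboxes B)%N -> bl v = bl v.+1 ->
        (bl v < p)%N -> v \in descents U,
      forall v, (0 < v < nboxes B)%N -> bl v = bl v.+1 ->
        (p <= bl v < p + q)%N -> v \notin descents U
    & (count (fun v => p + q <= bl v)%N (iota 1 (nboxes B)) <= rects B q.+1 p.+1)%N].
Proof.
have fD := skew_diagram B; have fb := @in_skew_box B.
pose f := in_skew B; pose r := nrows B; pose c := ncols B.
pose K (b : box B) := block_key f r c p q (brow b) (bcol b).
pose be (b : box B) := block f p q (brow b) (bcol b).
have [|b b' er hc|b b' ec hr|U sU ordU] := @syt_of_key B K.
- by move=> b b' /(block_key_inj fD (fb b) (fb b'))[]; apply: box_inj.
- by move: (fb b) (fb b'); rewrite /K er => h h'; exact: (block_key_row p q fD h h' hc).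
- by move: (fb b) (fb b'); rewrite /K ec => h h'; exact: (block_key_col p q fD h h' hr).
exists U => //.
(* The label of an entry is the block of its box; the default 0 concerns only values outside
   [1, ..., nboxes B]. *)
pose bl v := if [pick b | entry U b == v] is Some b then be b else 0%N.
have blE b : bl (entry U b) = be b.
  rewrite /bl; case: pickP => [x /eqP/(entry_inj sU)->|/(_ b)] //.
  by rewrite eqxx.
have onto v : (0 < v <= nboxes B)%N -> exists2 b, entry U b = v & bl v = be b.
  by case/(entry_onto sU) => b e; exists b; rewrite -?blE ?e.
have next v : (0 < v < nboxes B)%N -> exists b b',
   [/\ entry U b = v, entry U b' = v.+1, bl v = be b, bl v.+1 = be b' & (K b < K b')%N].
  move=> hv; have [|b eb lb] := onto v; first by lia.
  have [|b' eb' lb'] := onto v.+1; first by lia.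
  by exists b, b'; rewrite -ordU eb eb'.
exists bl; split.
- move=> v w vw wn; have [|b eb ->] := onto v; first by lia.
  have [|b' eb' ->] := onto w; first by lia.
  case: (ltngtP v w) => h; [|by lia|by rewrite (@entry_inj _ _ sU b b') // eb eb'].
  have : (K b < K b')%N by rewrite -ordU eb eb'.
  by rewrite /K (block_key_lt p q fD (fb b) (fb b')) -/(be b) -/(be b'); lia.
- move=> v /next[b [b' [eb eb' -> -> kk]]] e hp.
  rewrite -eb (mem_descents sU (b' := b')) ?eb ?eb' //.
  exact: (vertical_block fD (fb b) (fb b') kk e hp).
- move=> v /next[b [b' [eb eb' -> -> kk]]] e hp.
  rewrite -eb (mem_descents sU (b' := b')) ?eb ?eb' // -leqNgt.
  exact: (horizontal_block fD (fb b) (fb b') kk e hp).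
pose S := [set b : box B | (p + q <= be b)%N].
apply: (@leq_trans #|S|).
  rewrite -size_filter cardE -(size_map (entry U)); apply: uniq_leq_size.
    by rewrite filter_uniq // iota_uniq.
  move=> v; rewrite mem_filter mem_iota => /andP[hv hn].
  have [|b eb lb] := onto v; first by lia.
  by rewrite -eb map_f // mem_enum inE -lb.
have lastS b : b \in S -> [/\ (q <= brow b)%N, (p <= bcol b)%N &
    forall x y, (brow b - q <= x <= brow b)%N -> (bcol b - p <= y <= bcol b)%N -> f x y].
  by rewrite inE; exact: (last_block fD (fb b)).
(* On the last block the subtractions in [nw_corner] do not truncate, so the map is injective there
   and its values are top-left boxes of rectangles. *)
rewrite -(@card_in_imset _ _ (@nw_corner B p q)).
  apply: subset_leq_card; apply/subsetP => _ /imsetP[b /lastS[qi pj h] ->].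
  rewrite inE; apply/all_iota => x hx; apply/all_iota => y hy.
  by apply: h; move: qi pj hx hy; rewrite /brow /bcol /=; lia.
move=> b b' /lastS[qi pj _] /lastS[qi' pj' _] [er ec]; apply: box_inj.
  by rewrite -(subnK qi) -(subnK qi'); congr addn; apply: er.
by rewrite -(subnK pj) -(subnK pj'); congr addn; apply: ec.
Qed.

Lemma F_positive_rects A B :
  F_positive (skew_schur A \- skew_schur B) -> rects_cond A B.
Proof.
move=> pos [//|q] [//|p] _ _; have [U sU [bl [h1 h2 h3 h4]]] := strip_tableau B p q.
have [T sT /descent_comp_inj[en ed]] := F_positive_descents pos sU.
(* The labels built from [U] serve [T] as well, since size and descents agree. *)
apply: leq_trans h4; rewrite -en; rewrite -en -ed in h1 h2 h3.
exact: (rects_le_labels sT h1 h2 h3).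
Qed.

Theorem corollary4p2 (A B : skew_shape) :
  ((rows_cond A B <-> cols_cond A B) /\ (cols_cond A B <-> rects_cond A B)) /\
  (F_positive (skew_schur A \- skew_schur B) ->
   [/\ rows_cond A B, cols_cond A B & rects_cond A B]).
Proof.
have [rr rr'] := rows_rects A B; have [cr cr'] := cols_rects A B.
split; first by split; split; auto.
by move/F_positive_rects => h; split; auto.
Qed.
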